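(* Let $L$ be a lattice, let $\mathrm{Tol}(L)$ be the set of all tolerances of $L$ and $\mathrm{ReWOR}(L)$ the set of all reflexive weak ordered relations on $L$, both ordered by inclusion. The mappings $$\alpha\colon \mathrm{ReWOR}(L)\to\mathrm{Tol}(L),\quad \alpha(R)=R\cap R^{-1},$$ and $$\beta\colon \mathrm{Tol}(L)\to\mathrm{ReWOR}(L),\quad \beta(T)={\leq}\circ T\circ{\leq},$$ are lattice isomorphisms and they are inverses of each other.
   Context: Binary relations are composed by: $(x,y)\in R\circ S$ iff there is $z$ with $(x,z)\in R$ and $(z,y)\in S$; $R^{-1}$ is the inverse relation; $\leq$ is the order of $L$. A binary relation on a lattice $L$ is compatible if it is a sublattice of $L^2=L\times L$. A tolerance of $L$ is a reflexive, symmetric, compatible relation $T\subseteq L^2$. A binary relation $R$ on a lattice $L$ is a weak ordered relation if: (1) for any $u,x,y,z\in L$, $u\leq x$, $(x,y)\in R$ and $y\leq z$ imply $(u,z)\in R$; (2) for any $t\in L$ and any nonempty finite $A\subseteq L$, if $(a,t)\in R$ for each $a\in A$ then $\left(\bigvee A,t\right)\in R$; (3) for any $z\in L$ and any nonempty finite $A\subseteq L$, if $(z,a)\in R$ for each $a\in A$ then $\left(z,\bigwedge A\right)\in R$. *)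

(* Defs.v *)
From HB Require Import structures.
From mathcomp Require Import all_boot all_order.
From mathcomp Require Import all_classical.

Set Implicit Arguments.
Unset Strict Implicit.
Unset Printing Implicit Defensive.

Import Order.TTheory.
Local Open Scope classical_set_scope.
Local Open Scope order_scope.

Section BinaryRelations.
Context {X : Type}.
Implicit Types R S : set (X * X).

(* The notation [\;] of relation_scope composes in the opposite order:
   [R \; S] relates x to y when (x, z) is in S and (z, y) is in R. *)
Definition rel_comp R S : set (X * X) :=
  [set xy | exists2 z, R (xy.1, z) & S (z, xy.2)].

Definition rel_inv R : set (X * X) := [set xy | R (xy.2, xy.1)].

Definition rel_reflexive R : Prop := forall x, R (x, x).

Definition rel_symmetric R : Prop := forall x y, R (x, y) -> R (y, x).

End BinaryRelations.

Section LatticeRelations.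
Context {d : Order.disp_t} {L : latticeType d}.
Implicit Types R T : set (L * L).

Definition le_rel : set (L * L) := [set xy | xy.1 <= xy.2].

(* [L *p L] is the library's product lattice, with componentwise operations. *)
Definition compatible R : Prop :=
  let S : {pred L *p L} := mem R in
  Order.ClosedPredicates.meet_closed S /\ Order.ClosedPredicates.join_closed S.

Lemma compatibleP R : compatible R <->
  forall x y x' y', R (x, y) -> R (x', y') ->
    R (x `&` x', y `&` y') /\ R (x `|` x', y `|` y').
Proof.
split=> [[mR jR] x y x' y' Rxy Rxy'|h].
  have Sxy : (x, y) \in R by exact/mem_set.
  have Sxy' : (x', y') \in R by exact/mem_set.
  by split; apply/set_mem; [exact: mR Sxy Sxy'|exact: jR Sxy Sxy'].
by split=> -[x y] [x' y'] /set_mem Rxy /set_mem Rxy';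
  apply/(@mem_set _ R); have [] := h _ _ _ _ Rxy Rxy'.
Qed.

Definition is_tolerance T : Prop :=
  [/\ rel_reflexive T, rel_symmetric T & compatible T].

(* In a lattice, a nonempty finite A has exactly one element in [supremums A],
   its join, and exactly one in [infimums A], its meet. *)
Definition weak_ordered R : Prop :=
  [/\ forall u x y z : L, u <= x -> R (x, y) -> y <= z -> R (u, z),
      forall (t : L) (A : set L) (j : L), finite_set A -> A !=set0 ->
        (forall a, A a -> R (a, t)) -> supremums A j -> R (j, t)
    & forall (z : L) (A : set L) (m : L), finite_set A -> A !=set0 ->
        (forall a, A a -> R (z, a)) -> infimums A m -> R (z, m)].

Definition is_rewor R : Prop := rel_reflexive R /\ weak_ordered R.

Lemma bigcap_tolerance (F : set (set (L * L))) :
  F `<=` is_tolerance -> is_tolerance (\bigcap_(T in F) T).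
Proof.
move=> FT; split.
- by move=> x T /FT[].
- by move=> x y xy T FT0; have [_ sT _] := FT _ FT0; exact: sT (xy T FT0).
- apply/compatibleP => x y x' y' xy xy'; split=> T FT0;
    by have [_ _ /compatibleP/(_ _ _ _ _ (xy T FT0) (xy' T FT0))[]] := FT _ FT0.
Qed.

Lemma bigcap_rewor (F : set (set (L * L))) :
  F `<=` is_rewor -> is_rewor (\bigcap_(R in F) R).
Proof.
move=> FR; split; first by move=> x R /FR[].
split.
- move=> u x y z ux xy yz R FR0; have [_ [h _ _]] := FR _ FR0.
  by apply: h ux _ yz; exact: xy.
- move=> t A j fA A0 At Aj R FR0; have [_ [_ h _]] := FR _ FR0.
  by apply: (h _ A) => // a Aa; exact: At.
- move=> z A m fA A0 At Am R FR0; have [_ [_ _ h]] := FR _ FR0.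
  by apply: (h _ A) => // a Aa; exact: At.
Qed.

End LatticeRelations.

Record Tol d (L : latticeType d) := MkTol {
  tol_rel :> set (L * L);
  tol_proof : `[< is_tolerance tol_rel >] }.

Record ReWOR d (L : latticeType d) := MkReWOR {
  rewor_rel :> set (L * L);
  rewor_proof : `[< is_rewor rewor_rel >] }.

(* Both sets carry the order induced by the inclusion order of [set (L * L)]. *)
HB.instance Definition _ d (L : latticeType d) := [isSub for @tol_rel d L].
HB.instance Definition _ d (L : latticeType d) :=
  [Choice of @Tol d L by <:].
HB.instance Definition _ d (L : latticeType d) :=
  Order.SubChoice_isSubPOrder.Build _ _ _ set_display (Tol L).

HB.instance Definition _ d (L : latticeType d) := [isSub for @rewor_rel d L].
HB.instance Definition _ d (L : latticeType d) :=
  [Choice of @ReWOR d L by <:].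
HB.instance Definition _ d (L : latticeType d) :=
  Order.SubChoice_isSubPOrder.Build _ _ _ set_display (ReWOR L).

Section Lattices.
Local Open Scope classical_set_scope.
Context {d : Order.disp_t} {L : latticeType d}.

Lemma tol_leP (T T' : Tol L) : reflect (tol_rel T `<=` tol_rel T') (T <= T').
Proof. exact: asboolP. Qed.

Lemma rewor_leP (R R' : ReWOR L) :
  reflect (rewor_rel R `<=` rewor_rel R') (R <= R').
Proof. exact: asboolP. Qed.

Lemma tolP (T : Tol L) : is_tolerance T.
Proof. exact/asboolP/tol_proof. Qed.

Lemma reworP (R : ReWOR L) : is_rewor R.
Proof. exact/asboolP/rewor_proof. Qed.

Lemma smallest_tolerance (G : set (L * L)) :
  is_tolerance (smallest is_tolerance G).
Proof. by apply: bigcap_tolerance => T []. Qed.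

Lemma smallest_rewor (G : set (L * L)) : is_rewor (smallest is_rewor G).
Proof. by apply: bigcap_rewor => R []. Qed.

Lemma setI_tolerance (T T' : Tol L) : is_tolerance (T `&` T').
Proof.
have -> : T `&` T' = \bigcap_(S in [set tol_rel T; tol_rel T']) S.
  by rewrite bigcap_setU !bigcap_set1.
by apply: bigcap_tolerance => S [] ->; exact: tolP.
Qed.

Lemma setI_rewor (R R' : ReWOR L) : is_rewor (R `&` R').
Proof.
have -> : R `&` R' = \bigcap_(S in [set rewor_rel R; rewor_rel R']) S.
  by rewrite bigcap_setU !bigcap_set1.
by apply: bigcap_rewor => S [] ->; exact: reworP.
Qed.

Definition tol_meet (T T' : Tol L) : Tol L :=
  MkTol (asboolT (setI_tolerance T T')).

Definition tol_join (T T' : Tol L) : Tol L :=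
  MkTol (asboolT (smallest_tolerance (T `|` T'))).

Definition rewor_meet (R R' : ReWOR L) : ReWOR L :=
  MkReWOR (asboolT (setI_rewor R R')).

Definition rewor_join (R R' : ReWOR L) : ReWOR L :=
  MkReWOR (asboolT (smallest_rewor (R `|` R'))).

Lemma tol_meetP (T T1 T2 : Tol L) :
  (T <= tol_meet T1 T2) = (T <= T1) && (T <= T2).
Proof.
apply/tol_leP/andP => [/=|[/tol_leP ? /tol_leP ?]].
  by rewrite subsetI => -[? ?]; split; exact/tol_leP.
by rewrite /= subsetI.
Qed.

Lemma tol_joinP (T1 T2 T : Tol L) :
  (tol_join T1 T2 <= T) = (T1 <= T) && (T2 <= T).
Proof.
apply/tol_leP/andP => [/= h|[/tol_leP ? /tol_leP ?]].
  by split; apply/tol_leP; apply: subset_trans h; apply: sub_smallest;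
    [exact: subsetUl|exact: subsetUr].
by apply: smallest_sub; [exact: tolP|rewrite subUset].
Qed.

Lemma rewor_meetP (R R1 R2 : ReWOR L) :
  (R <= rewor_meet R1 R2) = (R <= R1) && (R <= R2).
Proof.
apply/rewor_leP/andP => [/=|[/rewor_leP ? /rewor_leP ?]].
  by rewrite subsetI => -[? ?]; split; exact/rewor_leP.
by rewrite /= subsetI.
Qed.

Lemma rewor_joinP (R1 R2 R : ReWOR L) :
  (rewor_join R1 R2 <= R) = (R1 <= R) && (R2 <= R).
Proof.
apply/rewor_leP/andP => [/= h|[/rewor_leP ? /rewor_leP ?]].
  by split; apply/rewor_leP; apply: subset_trans h; apply: sub_smallest;
    [exact: subsetUl|exact: subsetUr].
by apply: smallest_sub; [exact: reworP|rewrite subUset].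
Qed.

End Lattices.

HB.instance Definition _ d (L : latticeType d) :=
  Order.POrder_MeetJoin_isLattice.Build set_display (Tol L)
    tol_meetP tol_joinP.

HB.instance Definition _ d (L : latticeType d) :=
  Order.POrder_MeetJoin_isLattice.Build set_display (ReWOR L)
    rewor_meetP rewor_joinP.

Definition lattice_isomorphism d d' (M : latticeType d) (N : latticeType d')
    (f : M -> N) : Prop :=
  [/\ bijective f, Order.meet_morphism f & Order.join_morphism f].

(* Main.v *)
(** Adding a diagonal pair to [(a, b)] in [T], with [x <= a] and [b <= y], by
    [(x, b) = (x /\ a, x /\ b)] and then [(x \/ y, y)], moves it to
    [(x \/ y, y)] in [T]; by symmetry so is [(x, x \/ y)] when [y <= T <= x]
    too, and the meet of these two pairs is [(x, y)].  Hence
    [alpha (beta T) = T].  Conversely, a pair [(x, y)] of [R] factors as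
    [x <= x \/ y], [(x \/ y, y)], [y <= y] with the middle pair in [R] and in
    its inverse, so [beta (alpha R) = R].  Both maps are monotone, and monotone
    mutually inverse maps between lattices preserve meets and joins. *)
Require Import Defs.
From mathcomp Require Import all_boot all_order.
From mathcomp Require Import all_classical.

Set Implicit Arguments.
Unset Strict Implicit.
Unset Printing Implicit Defensive.

Import Order.TTheory.
Local Open Scope classical_set_scope.

Section MonotoneInverse.
Local Open Scope order_scope.
Context {d d' : Order.disp_t} {M : latticeType d} {N : latticeType d'}.

Lemma lattice_isomorphism_mono (f : M -> N) (g : N -> M) :
  {homo f : x y / x <= y} -> {homo g : x y / x <= y} ->
  cancel f g -> cancel g f -> lattice_isomorphism f.
Proof.
move=> fh gh fK gK; split; first by exists g.
- move=> x y; apply/le_anti; rewrite lexI !fh ?leIl ?leIr//=.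
  (* For the reverse inequality, the left side is written as [f] of its image under [g]; that image
     lies below both [x] and [y] because [g] is monotone and undoes [f]. *)
  rewrite -[leLHS]gK; apply: fh.
  by rewrite lexI -[X in _ <= X](fK x) -[X in _ && (_ <= X)](fK y)
    !gh ?leIl ?leIr.
- move=> x y; apply/le_anti; rewrite leUx !fh ?leUl ?leUr//= andbT.
  rewrite -[leRHS]gK; apply: fh.
  by rewrite leUx -[X in X <= _](fK x) -[X in _ && (X <= _)](fK y)
    !gh ?leUl ?leUr.
Qed.

End MonotoneInverse.

Section FiniteUBound.
Local Open Scope order_scope.
Context {d : Order.disp_t} {L : latticeType d}.
Implicit Types (P A : set L).

(** Joining the elements of [A] one at a time never leaves [P]. An upper bound is enough: a supremum
    lies below it, and the sets [P] used later are closed downwards. *)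
Lemma finite_ubound P A : (forall a b, P a -> P b -> P (a `|` b)) ->
  finite_set A -> A !=set0 -> A `<=` P -> exists2 u, P u & ubound A u.
Proof.
move=> PU /finite_seqP[s ->] [a0 /= a0s] sP.
have [u Pu us] : exists2 u, P u & forall a, a \in s -> a <= u.
  have {a0s}Pa0 := sP _ a0s.
  elim: s sP => [|b s ih] sP; first by exists a0.
  have [|u Pu us] := ih.
    by move=> a /= as_; apply: sP; rewrite /= inE as_ orbT.
  exists (b `|` u).
    by apply: PU => //; apply: sP; rewrite /= inE eqxx.
  by move=> a; rewrite inE => /predU1P[->|/us]; [exact: leUl|exact: lexUr].
by exists u.
Qed.

End FiniteUBound.

Section FiniteLBound.
Local Open Scope order_scope.
Context {d : Order.disp_t} {L : latticeType d}.
Implicit Types (P A : set L).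

Lemma finite_lbound P A : (forall a b, P a -> P b -> P (a `&` b)) ->
  finite_set A -> A !=set0 -> A `<=` P -> exists2 l, P l & lbound A l.
Proof. exact: (@finite_ubound _ L^d). Qed.

End FiniteLBound.

Section ToleranceWeakOrdered.
Local Open Scope order_scope.
Context {d : Order.disp_t} {L : latticeType d}.
Implicit Types (R T : set (L * L)).

Lemma supremums_pair (x y : L) : supremums [set x; y] (x `|` y).
Proof.
split=> [_ [->|->]|u uxy]; [exact: leUl|exact: leUr|].
by rewrite leUx !uxy//; [right|left].
Qed.

Lemma infimums_pair (x y : L) : infimums [set x; y] (x `&` y).
Proof.
split=> [_ [->|->]|l lxy]; [exact: leIl|exact: leIr|].
by rewrite lexI !lxy//; [right|left].
Qed.

(** Two-element sets give the binary laws. Conversely, binary joins or meets yield a suitably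
    related bound of [A], and the first condition passes from this bound to the supremum or
    infimum. *)
Lemma weak_orderedP R : weak_ordered R <->
  [/\ forall u x y z : L, u <= x -> R (x, y) -> y <= z -> R (u, z),
      forall x y t : L, R (x, t) -> R (y, t) -> R (x `|` y, t)
    & forall z x y : L, R (z, x) -> R (z, y) -> R (z, x `&` y)].
Proof.
split=> -[R1 R2 R3]; split=> //.
- move=> x y t xt yt; apply: (R2 _ [set x; y]) => //.
  + by exists x; left.
  + by move=> _ [->|->].
  + exact: supremums_pair.
- move=> z x y zx zy; apply: (R3 _ [set x; y]) => //.
  + by exists x; left.
  + by move=> _ [->|->].
  + exact: infimums_pair.
- move=> t A j fA A0 At [_ jmin].
  have [u ut Au] := finite_ubound (fun a b => R2 a b t) fA A0 At.
  exact: R1 (jmin _ Au) ut (lexx t).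
- move=> z A m fA A0 At [_ mmax].
  have [l zl Al] := finite_lbound (R3 z) fA A0 At.
  exact: R1 (lexx z) zl (mmax _ Al).
Qed.

Lemma rewor_le R x y : is_rewor R -> x <= y -> R (x, y).
Proof. by move=> [rR [R1 _ _]] xy; exact: R1 (lexx x) (rR x) xy. Qed.

Lemma tolerance_of_rewor R : is_rewor R -> is_tolerance (R `&` rel_inv R).
Proof.
move=> [rR /weak_orderedP[R1 R2 R3]]; split.
- by move=> x; split; exact: rR.
- by move=> x y [].
(* Lowering both first components to [x /\ x'] makes them equal, so the meet law in the second
   component applies; joins are dual. *)
have meetR x y x' y' : R (x, y) -> R (x', y') -> R (x `&` x', y `&` y').
  by move=> xy xy'; apply: R3;
    [apply: R1 xy _|apply: R1 xy' _]; rewrite ?leIl ?leIr.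
have joinR x y x' y' : R (x, y) -> R (x', y') -> R (x `|` x', y `|` y').
  by move=> xy xy'; apply: R2;
    [apply: R1 xy _|apply: R1 xy' _]; rewrite ?leUl ?leUr.
apply/compatibleP => x y x' y' [xy yx] [xy' yx'].
by split; split; [exact: meetR|exact: meetR|exact: joinR|exact: joinR].
Qed.

Lemma le_comp_leP T x y : rel_comp (rel_comp le_rel T) le_rel (x, y) <->
  exists a b, [/\ x <= a, T (a, b) & b <= y].
Proof.
split=> [[b [a xa ab] yb]|[a [b [xa ab yb]]]]; first by exists a, b.
by exists b => //; exists a.
Qed.

Lemma rewor_of_tolerance T :
  is_tolerance T -> is_rewor (rel_comp (rel_comp le_rel T) le_rel).
Proof.
move=> [rT _ /compatibleP cT]; split.
  by move=> x; apply/le_comp_leP; exists x, x.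
apply/weak_orderedP; split.
- move=> u x y z ux /le_comp_leP[a [b [xa ab yb]]] yz.
  apply/le_comp_leP; exists a, b.
  by split=> //; [exact: le_trans xa|exact: le_trans yz].
- move=> x y t /le_comp_leP[a [b [xa ab bt]]].
  move=> /le_comp_leP[a' [b' [ya ab' bt']]].
  (* Compatibility joins the two middle pairs, and [b \/ b'] stays below the common bound [t]. *)
  apply/le_comp_leP; exists (a `|` a'), (b `|` b').
  by split; [exact: leU2|have [] := cT _ _ _ _ ab ab'|rewrite leUx bt].
- move=> z x y /le_comp_leP[a [b [za ab bx]]].
  move=> /le_comp_leP[a' [b' [za' ab' by']]].
  apply/le_comp_leP; exists (a `&` a'), (b `&` b').
  by split; [rewrite lexI za|have [] := cT _ _ _ _ ab ab'|exact: leI2].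
Qed.

Lemma tolerance_le_comp_le T x y : is_tolerance T ->
  rel_comp (rel_comp le_rel T) le_rel (x, y) -> T (x `|` y, y).
Proof.
move=> [rT _ /compatibleP cT] /le_comp_leP[a [b [xa ab bley]]].
(* The meet with [(x, x)] is [(x, x /\ b)] since [x <= a]; the join with [(y, y)] is then
   [(x \/ y, y)] since [x /\ b <= b <= y]. *)
have [xb _] := cT _ _ _ _ (rT x) ab.
have [_] := cT _ _ _ _ xb (rT y).
by rewrite (meet_idPl xa) (join_idPr (leIxr x bley)).
Qed.

Lemma tolerance_of_reworK T : is_tolerance T ->
  let R := rel_comp (rel_comp le_rel T) le_rel in R `&` rel_inv R = T.
Proof.
move=> tT R; have [_ sT /compatibleP cT] := tT; apply/seteqP; split=> -[x y].
  move=> [/(tolerance_le_comp_le tT) xy /(tolerance_le_comp_le tT) /sT yx].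
  (* By absorption, the meet of [(x, y \/ x)] and [(x \/ y, y)] is [(x, y)]. *)
  by have [+ _] := cT _ _ _ _ yx xy; rewrite joinKI joinIKC.
move=> xy; split; apply/le_comp_leP; first by exists x, y.
by exists y, x; split; [|exact: sT|].
Qed.

Lemma rewor_of_toleranceK R : is_rewor R ->
  rel_comp (rel_comp le_rel (R `&` rel_inv R)) le_rel = R.
Proof.
move=> rwR; have [rR /weak_orderedP[R1 R2 _]] := rwR.
apply/seteqP; split=> -[x y].
  by move=> /le_comp_leP[a [b [xa [ab _] bley]]]; exact: R1 xa ab bley.
move=> xy; apply/le_comp_leP; exists (x `|` y), y.
split=> //; first exact: leUl.
(* The pair [(x \/ y, y)] comes from [(x, y)] and [(y, y)] by the join law; its inverse is in [R]
   because [R] contains the order. *)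
by split; [exact: R2|exact: (rewor_le rwR (leUr _ _))].
Qed.

End ToleranceWeakOrdered.

Theorem theorem2p6 (d : Order.disp_t) (L : latticeType d) :
  exists (alpha : ReWOR L -> Tol L) (beta : Tol L -> ReWOR L),
    (forall R : ReWOR L,
       tol_rel (alpha R) = rewor_rel R `&` rel_inv (rewor_rel R)) /\
    (forall T : Tol L,
       rewor_rel (beta T) = rel_comp (rel_comp le_rel (tol_rel T)) le_rel) /\
    lattice_isomorphism alpha /\
    lattice_isomorphism beta /\
    cancel alpha beta /\
    cancel beta alpha.
Proof.
pose alpha (R : ReWOR L) : Tol L :=
  MkTol (asboolT (tolerance_of_rewor (reworP R))).
pose beta (T : Tol L) : ReWOR L :=
  MkReWOR (asboolT (rewor_of_tolerance (tolP T))).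
(* Elements of either subtype are equal once their underlying relations are, so both cancellations
   reduce to identities between relations. *)
have alphaK : cancel alpha beta.
  by move=> R; apply: val_inj; exact: rewor_of_toleranceK (reworP R).
have betaK : cancel beta alpha.
  by move=> T; apply: val_inj; exact: tolerance_of_reworK (tolP T).
have alpha_mono : {homo alpha : R S / (R <= S)%O}.
  move=> R S /rewor_leP RS; apply/tol_leP => -[x y] [xy yx].
  by split; exact: RS.
have beta_mono : {homo beta : T U / (T <= U)%O}.
  move=> T U /tol_leP TU; apply/rewor_leP => -[x y].
  move=> /le_comp_leP[a [b [xa ab bley]]].
  by apply/le_comp_leP; exists a, b; split=> //; exact: TU.
exists alpha, beta; do 2![split=> //]; split.
  exact: lattice_isomorphism_mono alpha_mono beta_mono alphaK betaK.
split=> //.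
exact: lattice_isomorphism_mono beta_mono alpha_mono betaK alphaK.
Qed.
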